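(* Let $k$ be a field. If in a group $G$ an element $g$ commutes with a conjugate $h^{-1}gh\neq g$ (where $h\in G$), then in the group algebra $k\,G$, the trinomial $1+h-[g,h]$ generates the improper ideal.
   Context: For group elements $g,h$, $[g,h]=g^{-1}h^{-1}gh$. A trinomial is an element of $k\,G$ whose support (the set of group elements having nonzero coefficient in it) has cardinality $3$. ''Ideal'' means two-sided ideal; an element generates the improper ideal if the two-sided ideal it generates is all of $k\,G$. *)

(* Defs.v *)
From HB Require Import structures.
From mathcomp Require Import all_boot all_order all_fingroup all_algebra.
From mathcomp Require Import finmap monalg.

Set Implicit Arguments.
Unset Strict Implicit.
Unset Printing Implicit Defensive.

Import GRing.Theory.
Local Open Scope fset_scope.
Local Open Scope ring_scope.

(* [monalg] provides the free module {malg k[G]} of finitely supported         *)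
(* functions G -> k for any choiceType G, but it equips it with a product only *)
(* when G is a [monomType], a monoid in which x * y = 1 forces x = y = 1. That *)
(* excludes nontrivial groups, so the convolution product is set up here, on a *)
(* copy of {malg k[G]}.                                                        *)
Section Convolution.
Variables (k : comNzRingType) (G : groupType).
Implicit Types (a b c : {malg k[G]}) (x y : G) (r s : k).

Definition gamul a b : {malg k[G]} :=
  \sum_(x <- msupp a) \sum_(y <- msupp b) << a@_x * b@_y *g (x * y)%g >>.

Definition gaone : {malg k[G]} := << 1%g >>.

Lemma gamulw (d1 d2 : {fset G}) a b : msupp a `<=` d1 -> msupp b `<=` d2 ->
  gamul a b = \sum_(x <- d1) \sum_(y <- d2) << a@_x * b@_y *g (x * y)%g >>.
Proof.
move=> le1 le2; rewrite /gamul (big_fset_incl _ le1) /=.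
  apply/eq_bigr=> x _; apply/big_fset_incl => // y _ /mcoeff_outdom ->.
  by rewrite mulr0 monalgU0.
move=> x _ /mcoeff_outdom ax.
by rewrite big1 // => y _; rewrite ax mul0r monalgU0.
Qed.

Lemma gamulDl : left_distributive gamul +%R.
Proof.
move=> a b c.
rewrite (gamulw (fsubsetUl (msupp a) (msupp b)) (fsubset_refl (msupp c))).
rewrite (gamulw (fsubsetUr (msupp a) (msupp b)) (fsubset_refl (msupp c))).
rewrite (gamulw (msuppD_le a b) (fsubset_refl (msupp c))).
rewrite -big_split /=; apply/eq_bigr=> x _.
rewrite -big_split /=; apply/eq_bigr=> y _.
by rewrite mcoeffD mulrDl monalgUD.
Qed.

Lemma gamulDr : right_distributive gamul +%R.
Proof.
move=> c a b.
rewrite (gamulw (fsubset_refl (msupp c)) (fsubsetUl (msupp a) (msupp b))).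
rewrite (gamulw (fsubset_refl (msupp c)) (fsubsetUr (msupp a) (msupp b))).
rewrite (gamulw (fsubset_refl (msupp c)) (msuppD_le a b)).
rewrite -big_split /=; apply/eq_bigr=> x _.
rewrite -big_split /=; apply/eq_bigr=> y _.
by rewrite mcoeffD mulrDr monalgUD.
Qed.

Lemma gamul0l : left_zero 0 gamul.
Proof. by move=> a; rewrite /gamul msupp0 big_seq_fset0. Qed.

Lemma gamul0r : right_zero 0 gamul.
Proof.
by move=> a; rewrite /gamul big1 // => x _; rewrite msupp0 big_seq_fset0.
Qed.

Lemma gamulUU r s x y :
  gamul << r *g x >> << s *g y >> = << r * s *g (x * y)%g >>.
Proof. by rewrite (gamulw msuppU_le msuppU_le) !big_seq_fset1 !mcoeffUU. Qed.

Lemma gamul_suml I (t : seq I) (F : I -> {malg k[G]}) b :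
  gamul (\sum_(i <- t) F i) b = \sum_(i <- t) gamul (F i) b.
Proof. exact: (big_morph (gamul^~ b) (fun _ _ => gamulDl _ _ _) (gamul0l _)). Qed.

Lemma gamul_sumr I (t : seq I) (F : I -> {malg k[G]}) b :
  gamul b (\sum_(i <- t) F i) = \sum_(i <- t) gamul b (F i).
Proof. exact: (big_morph (gamul b) (fun _ _ => gamulDr _ _ _) (gamul0r _)). Qed.

Lemma gamul1l : left_id gaone gamul.
Proof.
move=> a; rewrite /gaone (gamulw msuppU_le (fsubset_refl (msupp a))).
rewrite big_seq_fset1.
rewrite [RHS](monalgE a); apply/eq_bigr=> x _.
by rewrite mcoeffUU mul1r mul1g.
Qed.

Lemma gamul1r : right_id gaone gamul.
Proof.
move=> a; rewrite /gaone (gamulw (fsubset_refl (msupp a)) msuppU_le).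
rewrite [RHS](monalgE a); apply/eq_bigr=> x _.
by rewrite big_seq_fset1 mcoeffUU mulr1 mulg1.
Qed.

Lemma gamulA : associative gamul.
Proof.
move=> a b c; rewrite [in LHS](monalgE a) [in RHS](monalgE a) !gamul_suml.
apply/eq_bigr=> x _; rewrite [in LHS](monalgE b) [in RHS](monalgE b).
rewrite gamul_suml !gamul_sumr gamul_suml; apply/eq_bigr=> y _.
rewrite [in LHS](monalgE c) [in RHS](monalgE c) !gamul_sumr.
apply/eq_bigr=> z _.
by rewrite !gamulUU mulrA mulgA.
Qed.

Lemma gaone_neq0 : gaone != 0.
Proof. by rewrite monalgU_eq0 oner_neq0. Qed.

Lemma gascaleU r s x : r *: (<< s *g x >> : {malg k[G]}) = << r * s *g x >>.
Proof. by apply/malgP=> y; rewrite mcoeffZ !mcoeffU mulrnAr. Qed.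

Lemma gascaleAl r a b : r *: gamul a b = gamul (r *: a) b.
Proof.
rewrite (gamulw (msuppZ_le r a) (fsubset_refl (msupp b))) /gamul scaler_sumr.
apply/eq_bigr=> x _; rewrite scaler_sumr; apply/eq_bigr=> y _.
by rewrite gascaleU mcoeffZ mulrA.
Qed.

Lemma gascaleAr r a b : r *: gamul a b = gamul a (r *: b).
Proof.
rewrite (gamulw (fsubset_refl (msupp a)) (msuppZ_le r b)) /gamul scaler_sumr.
apply/eq_bigr=> x _; rewrite scaler_sumr; apply/eq_bigr=> y _.
by rewrite gascaleU mcoeffZ mulrCA.
Qed.

End Convolution.

Definition group_algebra (k : comNzRingType) (G : groupType) : Type :=
  {malg k[G]}.

Section GroupAlgebra.
Variables (k : comNzRingType) (G : groupType).

HB.instance Definition _ := GRing.Lmodule.copy (group_algebra k G) {malg k[G]}.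
HB.instance Definition _ := GRing.Zmodule_isNzRing.Build (group_algebra k G)
  (@gamulA k G) (@gamul1l k G) (@gamul1r k G) (@gamulDl k G) (@gamulDr k G)
  (@gaone_neq0 k G).
HB.instance Definition _ :=
  GRing.Lmodule_isLalgebra.Build k (group_algebra k G) (@gascaleAl k G).
HB.instance Definition _ :=
  GRing.Lalgebra_isAlgebra.Build k (group_algebra k G) (@gascaleAr k G).

Definition ga_elt (x : G) : group_algebra k G := << x >>.

Definition trinomial (a : group_algebra k G) : Prop := #|` msupp a| = 3%N.

End GroupAlgebra.

Section Ideals.
Variable A : pzRingType.
Implicit Types (I : A -> Prop) (x y : A).

(* The ideal predicate of [ring_quotient] is not used: it demands 1 \notin I   *)
(* and is one-sided.                                                           *)
Definition two_sided_ideal I : Prop :=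
  [/\ I 0,
      forall x y, I x -> I y -> I (x - y),
      forall x y, I y -> I (x * y)
    & forall x y, I x -> I (x * y)].

Definition ideal_generated_by x : A -> Prop :=
  fun y => forall I, two_sided_ideal I -> I x -> I y.

Definition generates_improper_ideal x : Prop :=
  forall y, ideal_generated_by x y.

End Ideals.

(* Main.v *)
Require Import Defs.
From mathcomp Require Import all_boot all_order all_fingroup all_algebra.
From mathcomp Require Import finmap monalg.

(** Write c for the commutator of g and h. Modulo the ideal I generated by
    1 + h - c, the element h becomes c - 1. Since g commutes with its conjugate
    h^-1 g h, it commutes with c = g^-1 (h^-1 g h), hence with h modulo I. But
    then c itself becomes 1, so h = c - 1 becomes 0; as h is a unit, the
    quotient by I is the zero ring. The lemma
    [ideal_of_commutator_trinomial_contains1] is this argument carried out on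
    elements of I.

    The support has three elements because c = 1 would give h^-1 g h = g, and
    either of h = 1 and h = c (that is, g^-1 h^-1 g = 1) would give h = 1, again
    contrary to h^-1 g h <> g. *)

Set Implicit Arguments.
Unset Strict Implicit.
Unset Printing Implicit Defensive.

Import GRing.Theory.
Local Open Scope ring_scope.

Lemma ga_eltM (k : comNzRingType) (G : groupType) (x y : G) :
  ga_elt k (x * y)%g = ga_elt k x * ga_elt k y.
Proof. by rewrite [RHS]gamulUU mulr1. Qed.

Lemma ga_elt1 (k : comNzRingType) (G : groupType) : ga_elt k (1%g : G) = 1.
Proof. by []. Qed.

Lemma ideal_opp (A : pzRingType) (I : A -> Prop) (x : A) :
  two_sided_ideal I -> I x -> I (- x).
Proof. by case=> I0 IB _ _ Ix; rewrite -[- x]sub0r; apply: IB. Qed.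

Lemma ideal_add (A : pzRingType) (I : A -> Prop) (x y : A) :
  two_sided_ideal I -> I x -> I y -> I (x + y).
Proof.
move=> idI Ix Iy; rewrite -[y]opprK; case: (idI) => _ IB _ _.
by apply: IB => //; apply: ideal_opp.
Qed.

Lemma trinomial_three_points (k : comNzRingType) (G : groupType) (x y z : G) :
  x != y -> x != z -> y != z ->
  trinomial (ga_elt k x + ga_elt k y - ga_elt k z).
Proof.
move=> xy xz yz; rewrite /trinomial.
have -> : msupp (ga_elt k x + ga_elt k y - ga_elt k z)
          = [fset x; y; z]%fset.
  apply/fsetP=> w; rewrite !inE -mcoeff_neq0 mcoeffB mcoeffD !mcoeffU.
  rewrite ![w == _]eq_sym.
  (* Each coefficient is a sum of three indicators, at most one of which is
     nonzero. *)
  have [<-|_] := eqVneq x w.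
    by rewrite (eq_sym y) (negbTE xy) (eq_sym z) (negbTE xz) addr0 subr0
      oner_neq0.
  have [<-|_] := eqVneq y w.
    by rewrite (eq_sym z) (negbTE yz) add0r subr0 oner_neq0.
  have [_|_] := eqVneq z w; first by rewrite !add0r oppr_eq0 oner_neq0.
  by rewrite !add0r oppr0 eqxx.
by rewrite -!fsetUA !cardfsU1 cardfs1 !inE negb_or xy xz yz.
Qed.

(** Since 1 and c commute with g, they cancel in the commutator of 1 + h - c
    with g, which leaves gh - hg = hg(c - 1) in I. Thus c - 1 lies in I, hence
    so does the unit h = (1 + h - c) + (c - 1). *)
Lemma ideal_of_commutator_trinomial_contains1 (k : comNzRingType) (G : groupType)
    (g h : G) (I : group_algebra k G -> Prop) :
  commute g [~ g, h]%g -> two_sided_ideal I ->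
  I (1 + ga_elt k h - ga_elt k [~ g, h]%g) -> I 1.
Proof.
set c := [~ g, h]%g => gc idI; set t := (X in I X) => It.
have [_ IB IMl IMr] := idI.
have Igh : I (ga_elt k (g * h)%g - ga_elt k (h * g)%g).
  suff <- : ga_elt k g * t - t * ga_elt k g
            = ga_elt k (g * h)%g - ga_elt k (h * g)%g.
    by apply: IB; [apply: IMl | apply: IMr].
  rewrite /t mulrBr mulrDr mulrBl mulrDl mulr1 mul1r -!ga_eltM gc.
  by rewrite opprB addrA subrK opprD addrACA subrr add0r.
have Ic : I (ga_elt k c - 1).
  suff <- : ga_elt k ((h * g)^-1)%g
              * (ga_elt k (g * h)%g - ga_elt k (h * g)%g) = ga_elt k c - 1.
    exact: IMl.
  rewrite mulrBr -!ga_eltM mulVg ga_elt1; congr (ga_elt k _ - 1).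
  by rewrite /c commgEl conjgE invgM !mulgA.
have Ih : I (ga_elt k h).
  suff -> : ga_elt k h = t + (ga_elt k c - 1) by apply: ideal_add.
  by rewrite /t addrA subrK addrAC subrr add0r.
by rewrite -ga_elt1 -(mulVg h) ga_eltM; apply: IMl.
Qed.

Theorem corollary7 (k : fieldType) (G : groupType) (g h : G) :
  commute g (h^-1 * g * h)%g -> (h^-1 * g * h)%g <> g ->
  let t : group_algebra k G := 1 + ga_elt k h - ga_elt k [~ g, h]%g in
  trinomial t /\ generates_improper_ideal t.
Proof.
move=> cgh ngh /=.
have cE : [~ g, h]%g = (g^-1 * (h^-1 * g * h))%g.
  by rewrite commgEl conjgE !mulgA.
have h1 : h <> 1%g by move=> h1; apply: ngh; rewrite h1 invg1 mul1g mulg1.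
split.
  rewrite -ga_elt1; apply: trinomial_three_points.
  - by apply/eqP=> /esym.
  - apply/eqP=> /(congr1 (mulg g)); rewrite cE mulg1 mulKVg.
    by move/esym.
  - (* h = g^-1 h^-1 g h says that h^-1 is conjugate to 1. *)
    apply/eqP; rewrite cE !mulgA -{1}[h]mul1g => /mulIg /esym e.
    by apply/h1/eqP; rewrite -invg_eq1 -(conjg_eq1 _ g) conjgE mulgA e.
move=> y I idI It; have [_ _ IMl _] := idI.
rewrite -[y]mulr1; apply: IMl.
apply: (ideal_of_commutator_trinomial_contains1 _ idI It).
rewrite cE; apply: commuteM => //.
by rewrite /commute mulgV mulVg.
Qed.
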